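(* Let $A\in\mathbb R$, $T>0$, and let $u_0\in L^2(\mathbb R)$ be a nonnegative probability density with finite second moment. Let $u(x,t)=u_0(x-At)$, $t\in[0,T]$, be the solution of the linear advection equation $u_t+A\,u_x=0$ on $\mathbb R$ with $u(\cdot,0)=u_0$. Let $r$ be a fixed reference probability density, let $\widehat{u_0}$ denote the CDT of $u_0$ with respect to $r$, and let $\mathbf 1$ denote the constant function one. Then the transformed solution manifold $\widehat{\mathcal M}_{[0,T]}:=\{\widehat u(\cdot,t):t\in[0,T]\}$ satisfies $$\widehat{\mathcal M}_{[0,T]}=\{\widehat{u_0}+t\,A\mathbf 1:\ t\in[0,T]\}\subset\operatorname{span}\{\widehat{u_0},\mathbf 1\}\subset L^2(dr),$$ and consequently $$d_n\big(\widehat{\mathcal M}_{[0,T]};L^2(dr)\big)=0\qquad\text{for every integer } n\ge 2.$$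
   Context: CDT: for a probability density $w$ on $\mathbb R$ with finite second moment, $F_w(x)=\int_{-\infty}^xw(s)\,ds$, $F_w^\dagger(p)=\inf\{x\in\mathbb R:F_w(x)\ge p\}$ for $p\in(0,1)$, and the cumulative distribution transform (CDT) of $w$ with respect to $r$ is $\widehat w(\xi)=F_w^\dagger(F_r(\xi))$, understood $r(\xi)d\xi$-a.e. For a time-dependent $u$, $\widehat u(\cdot,t)$ is the CDT of $u(\cdot,t)$. $L^2(dr)$ is the $L^2$ space with respect to the measure $r(\xi)\,d\xi$. Kolmogorov $n$-width: for a subset $\mathcal S$ of a Hilbert space $\mathcal H$, $d_n(\mathcal S;\mathcal H)=\inf_{V\subset\mathcal H,\ \dim V\le n}\ \sup_{w\in\mathcal S}\ \inf_{h\in V}\|w-h\|_{\mathcal H}$, the infimum being over linear subspaces $V$. *)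

(* Defs.v *)
From HB Require Import structures.
From mathcomp Require Import all_boot all_order all_algebra.
From mathcomp Require Import all_classical all_reals all_analysis.
From mathcomp Require Import ess_sup_inf measurable_realfun.

Set Implicit Arguments.
Unset Strict Implicit.
Unset Printing Implicit Defensive.
Import Order.TTheory GRing.Theory Num.Theory.
Import numFieldNormedType.Exports.

Local Open Scope classical_set_scope.
Local Open Scope ring_scope.

Section Lnorm_ae.
Context d (T : measurableType d) (R : realType).
Variables (mu : {measure set T -> \bar R}) (p : \bar R).

Lemma ae_eq_Lnorm (f g : T -> R) : (1 <= p)%E ->
  measurable_fun setT f -> measurable_fun setT g -> f = g %[ae mu] ->
  ('N[mu]_p[EFin \o f] = 'N[mu]_p[EFin \o g])%E.
Proof.
rewrite unlock; case: p => [r _|_|//] mf mg fg.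
- have mpow (h : T -> R) : measurable_fun setT h ->
      measurable_fun setT (fun x => (`|(EFin \o h) x| `^ r)%E).
    move=> mh; apply/measurable_EFinP.
    apply: (@measurableT_comp _ _ _ _ _ _ (fun x : R => x `^ r)) => //.
    exact: measurableT_comp.
  apply: (congr1 (fun x => x `^ r^-1)%E); apply: ge0_ae_eq_integral.
  + exact: measurableT.
  + exact: mpow.
  + exact: mpow.
  + by move=> x _; exact: poweR_ge0.
  + by move=> x _; exact: poweR_ge0.
  + by apply: filterS fg => x /= /[apply] ->.
- suff -> : ess_sup mu (abse \o (EFin \o f)) = ess_sup mu (abse \o (EFin \o g)) by [].
  by apply: eq_ess_sup; apply: filterS fg => x /= /(_ I) ->.
Qed.

End Lnorm_ae.

(* The library's Lp space, [LspaceType mu p1], is a quotient by a.e. equality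
   without algebraic structure; it is made a normed module here. *)
Section Lspace_normedModType.
Context d (T : measurableType d) (R : realType).
Variables (mu : {measure set T -> \bar R}) (p : \bar R) (p1 : (1 <= p)%E).

Local Notation L := (LspaceType mu p1).
Local Notation LF := (LfunType mu p1).
Local Notation Q := {mfun_ mu, T >-> measurableTypeR R}.
Local Open Scope quotient_scope.

Let mfun_of (f : LF) : {mfun T >-> measurableTypeR R} :=
  HB.pack_for {mfun T >-> measurableTypeR R} (f : T -> R)
    (@isMeasurableFun.Build _ _ T (measurableTypeR R) f
      (@measurable_funPT _ _ _ _ f)).

Let pi_mfun (f : LF) : Q := \pi_Q (mfun_of f).

Let pi_mfunE (f : LF) : (pi_mfun f : T -> R) = f %[ae mu].
Proof.
have : \pi_Q (repr (pi_mfun f)) = \pi_Q (mfun_of f) by rewrite reprK.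
by move=> /eqquotP/asboolP.
Qed.

Let pi_mfun_finite (f : LF) : finite_norm mu p (pi_mfun f : T -> R).
Proof.
rewrite /finite_norm (ae_eq_Lnorm p1 _ _ (pi_mfunE f)).
- exact: Lfunction_finite.
- exact: (@measurable_funPT _ _ _ _ (repr (pi_mfun f))).
- exact: measurable_funPT.
Qed.

Definition Lspace_of_Lfun (f : LF) : L :=
  HB.pack_for L (pi_mfun f)
    (isFinLebesgue.Build d T R mu p p1 (pi_mfun f) (pi_mfun_finite f)).

Lemma Lspace_of_LfunE (f : LF) : (Lspace_of_Lfun f : T -> R) = f %[ae mu].
Proof. exact: pi_mfunE. Qed.

Lemma LspaceP (f g : L) : (f : T -> R) = g %[ae mu] -> f = g.
Proof.
case: f g => [f [[fn]]] [g [[gn]]] /= fg.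
have fgE : f = g by rewrite -[f]reprK -[g]reprK; apply/eqquotP/asboolP.
by case: _ / fgE gn {fg} => gn; rewrite (Prop_irrelevance fn gn).
Qed.

Let Lspace_Lfun (f : L) : (f : T -> R) \in Lfun mu p.
Proof.
rewrite inE; apply/andP; split; rewrite inE /=; last exact: Lebesgue_finite.
exact: (@measurable_funPT _ _ _ _ (repr (f : Q))).
Qed.

Definition Lfun_of_Lspace (f : L) : LF := Lfun_Sub p1 (Lspace_Lfun f).

Lemma Lspace_eqP (f g : LF) :
  Lspace_of_Lfun f = Lspace_of_Lfun g <-> (f : T -> R) = g %[ae mu].
Proof.
split=> [fg|fg].
  apply: ae_eq_trans (Lspace_of_LfunE g); apply: ae_eq_sym.
  by rewrite -fg; exact: Lspace_of_LfunE.
apply: LspaceP; apply: ae_eq_trans (Lspace_of_LfunE f) _.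
exact/(ae_eq_trans fg)/ae_eq_sym/Lspace_of_LfunE.
Qed.

Lemma Lfun_of_LspaceK (f : L) : Lspace_of_Lfun (Lfun_of_Lspace f) = f.
Proof. exact/LspaceP/Lspace_of_LfunE. Qed.

HB.instance Definition _ := gen_eqMixin L.
HB.instance Definition _ := gen_choiceMixin L.

Let add (f g : L) : L := Lspace_of_Lfun (Lfun_of_Lspace f + Lfun_of_Lspace g).
Let opp (f : L) : L := Lspace_of_Lfun (- Lfun_of_Lspace f).
Let scale (a : R) (f : L) : L := Lspace_of_Lfun (a *: Lfun_of_Lspace f).

Let addE f g :
  add (Lspace_of_Lfun f) (Lspace_of_Lfun g) = Lspace_of_Lfun (f + g).
Proof.
apply/Lspace_eqP; apply: filterS2 (Lspace_of_LfunE f) (Lspace_of_LfunE g).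
by move=> x /= fx gx _; congr (_ + _); [exact: fx|exact: gx].
Qed.

Let oppE f : opp (Lspace_of_Lfun f) = Lspace_of_Lfun (- f).
Proof.
apply/Lspace_eqP; apply: filterS (Lspace_of_LfunE f).
by move=> x /= fx _; congr (- _); exact: fx.
Qed.

Let scaleE a f : scale a (Lspace_of_Lfun f) = Lspace_of_Lfun (a *: f).
Proof.
apply/Lspace_eqP; apply: filterS (Lspace_of_LfunE f).
by move=> x /= fx _; congr (a * _); exact: fx.
Qed.

Let addA : associative add.
Proof.
move=> f g h; rewrite -[f]Lfun_of_LspaceK -[g]Lfun_of_LspaceK.
by rewrite -[h]Lfun_of_LspaceK !addE addrA.
Qed.

Let addC : commutative add.
Proof. by move=> f g; rewrite /add addrC. Qed.

Let add0 : left_id (Lspace_of_Lfun 0) add.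
Proof. by move=> f; rewrite -[f]Lfun_of_LspaceK addE add0r. Qed.

Let addN : left_inverse (Lspace_of_Lfun 0) opp add.
Proof. by move=> f; rewrite -[f]Lfun_of_LspaceK oppE addE addNr. Qed.

HB.instance Definition _ := GRing.isZmodule.Build L addA addC add0 addN.

Let scaleA a b f : scale a (scale b f) = scale (a * b) f.
Proof. by rewrite -[f]Lfun_of_LspaceK !scaleE scalerA. Qed.

Let scale1 : left_id 1 scale.
Proof. by move=> f; rewrite -[f]Lfun_of_LspaceK scaleE scale1r. Qed.

Let scaleDr : right_distributive scale +%R.
Proof.
move=> a f g; rewrite -[f]Lfun_of_LspaceK -[g]Lfun_of_LspaceK.
by rewrite ![_ + _]addE !scaleE [RHS]addE scalerDr.
Qed.

Let scaleDl f : {morph scale^~ f : a b / a + b}.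
Proof.
move=> a b; rewrite -[f]Lfun_of_LspaceK !scaleE [RHS]addE.
by rewrite scalerDl.
Qed.

HB.instance Definition _ :=
  GRing.Zmodule_isLmodule.Build R L scaleA scale1 scaleDr scaleDl.

Let norm (f : L) : R := fine 'N[mu]_p[EFin \o f]%E.

Let normE (f : LF) : norm (Lspace_of_Lfun f) = fine 'N[mu]_p[EFin \o f]%E.
Proof.
congr fine; apply: (ae_eq_Lnorm p1 _ _ (Lspace_of_LfunE f)).
- exact: (@measurable_funPT _ _ _ _ (Lfun_of_Lspace (Lspace_of_Lfun f))).
- exact: measurable_funPT.
Qed.

Let ler_normD f g : norm (f + g) <= norm f + norm g.
Proof.
rewrite -[f]Lfun_of_LspaceK -[g]Lfun_of_LspaceK [f in norm f]addE !normE.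
exact: ler_LnormD.
Qed.

Let normrZ a f : norm (a *: f) = `|a| * norm f.
Proof.
rewrite -[f]Lfun_of_LspaceK [f in norm f]scaleE !normE.
by apply/EFin_inj; rewrite EFinM !finite_norm_fine -LnormZ.
Qed.

Let normr0_eq0 f : norm f = 0 -> f = 0.
Proof.
rewrite -[f]Lfun_of_LspaceK normE => /fine_Lnormr_eq0 f0.
exact/Lspace_eqP.
Qed.

HB.instance Definition _ :=
  Lmodule_isNormed.Build R L ler_normD normrZ normr0_eq0.

Lemma Lspace_of_LfunD (f g : LF) :
  Lspace_of_Lfun (f + g) = Lspace_of_Lfun f + Lspace_of_Lfun g.
Proof. by rewrite [RHS]addE. Qed.

Lemma Lspace_of_LfunZ (a : R) (f : LF) :
  Lspace_of_Lfun (a *: f) = a *: Lspace_of_Lfun f.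
Proof. by rewrite [RHS]scaleE. Qed.

Lemma normr_Lspace_of_Lfun (f : LF) :
  `|Lspace_of_Lfun f| = fine 'N[mu]_p[EFin \o f]%E.
Proof. exact: normE. Qed.

End Lspace_normedModType.

(* The class in L^p of a function; it is the zero class, hence meaningless,
   when [f \notin Lfun mu p]. *)
Definition Lspace_class d (T : measurableType d) (R : realType)
    (mu : {measure set T -> \bar R}) (p : \bar R) (p1 : (1 <= p)%E)
    (f : T -> R) : LspaceType mu p1 :=
  Lspace_of_Lfun (insubd (0 : LfunType mu p1) f).

Lemma Lspace_classE d (T : measurableType d) (R : realType)
    (mu : {measure set T -> \bar R}) (p : \bar R) (p1 : (1 <= p)%E)
    (f : T -> R) :
  f \in Lfun mu p -> (Lspace_class mu p1 f : T -> R) = f %[ae mu].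
Proof.
move=> fL.
have fE : (insubd (0 : LfunType mu p1) f : T -> R) = f.
  by rewrite -[LHS]/(val (insubd (0 : LfunType mu p1) f)) val_insubd fL.
have := Lspace_of_LfunE (insubd (0 : LfunType mu p1) f).
by rewrite [X in _ = X %[ae _]]fE.
Qed.

Section linear_span.
Context (R : realType) (V : lmodType R).

Definition lin_span (S : set V) : set V :=
  [set v | exists k (c : 'I_k -> R) (x : 'I_k -> V),
    (forall i, S (x i)) /\ v = \sum_(i < k) c i *: x i].

Definition lin_indep k (b : 'I_k -> V) :=
  forall c : 'I_k -> R, \sum_(i < k) c i *: b i = 0 -> forall i, c i = 0.

(* [W] is a linear subspace of [V] having a basis of at most [n] vectors. *)
Definition dim_le (n : nat) (W : set V) :=
  exists k (b : 'I_k -> V),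
    [/\ (k <= n)%N, lin_indep b & W = lin_span (range b)].

End linear_span.

(* Only the norm of the ambient Hilbert space enters the Kolmogorov width. *)
Definition kolmogorov_width (R : realType) (H : normedModType R) (n : nat)
    (S : set H) : \bar R :=
  ereal_inf [set ereal_sup [set ereal_inf [set `|w - h|%:E | h in V] | w in S]
            | V in [set V : set H | dim_le n V]].

Record prob_density (R : realType) := ProbDensity {
  density_fun :> R -> R;
  measurable_density : measurable_fun setT density_fun;
  density_ge0 : forall x, 0 <= density_fun x;
  integral_density : (\int[lebesgue_measure]_x (density_fun x)%:E = 1)%E
}.

Definition finite_second_moment (R : realType) (w : R -> R) :=
  (\int[lebesgue_measure]_x (x ^+ 2 * w x)%:E < +oo)%E.

Definition density_measure (R : realType) (r : prob_density R) :
    set _ -> \bar R :=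
  fun A => (\int[lebesgue_measure]_(x in A) (r x)%:E)%E.

Section density_measure.
Context (R : realType) (r : prob_density R).
Local Notation nu := (density_measure r).

Let nu0 : nu set0 = 0%E.
Proof. exact: integral_set0. Qed.

Let nu_ge0 A : (0 <= nu A)%E.
Proof. by apply: integral_ge0 => x _; rewrite lee_fin density_ge0. Qed.

Let nu_sigma_additive : semi_sigma_additive nu.
Proof.
apply: semi_sigma_additive_nng_induced => [|x].
  by apply/measurable_EFinP; exact: measurable_density.
by rewrite lee_fin density_ge0.
Qed.

HB.instance Definition _ := isMeasure.Build _ _ _ nu nu0 nu_ge0 nu_sigma_additive.

Let nu_setT : nu [set: _] = 1%E.
Proof. exact: integral_density. Qed.

HB.instance Definition _ := @Measure_isProbability.Build _ _ R nu nu_setT.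

End density_measure.

Definition density_cdf (R : realType) (w : R -> R) (x : R) : R :=
  \int[lebesgue_measure]_(s in `]-oo, x]) w s.

(* Only the values at [0 < p < 1] are meaningful: elsewhere the set may be
   empty or unbounded below, where the library's [inf] is [0]. *)
Definition quantile (R : realType) (w : R -> R) (p : R) : R :=
  inf [set x | p <= density_cdf w x].

Definition cdt (R : realType) (r w : R -> R) (xi : R) : R :=
  quantile w (density_cdf r xi).

Definition advected (R : realType) (A : R) (u0 : R -> R) (x t : R) : R :=
  u0 (x - A * t).

Definition L2 (R : realType) (r : prob_density R) :=
  LspaceType2 (density_measure r).

Definition L2_class (R : realType) (r : prob_density R) (f : R -> R) : L2 r :=
  Lspace_class (density_measure r) (lee1n 2) f.

Definition transformed_manifold (R : realType) (r : prob_density R)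
    (u : R -> R -> R) (T : R) : set (L2 r) :=
  [set L2_class r (cdt r (u ^~ t)) | t in `[0, T]].
Arguments transformed_manifold {R} r u T.

(* Main.v *)
(** Since the cumulative distribution function [F_r] of [r] is continuous,
    [F_r(xi)] is uniformly distributed on [0, 1] when [xi] has density [r];
    hence the CDT of [w] pushes [r] forward to [w], and its squared norm in
    [L^2(dr)] is the second moment of [w].  Translating a density by [c] adds
    [c] to its quantiles, so the transformed solutions all lie in the span of
    two vectors. *)

Require Import Defs.
From HB Require Import structures.
From mathcomp Require Import all_boot all_order all_algebra.
From mathcomp Require Import all_classical all_reals all_analysis.
From mathcomp Require Import unstable measurable_realfun lra.

Set Implicit Arguments.
Unset Strict Implicit.
Unset Printing Implicit Defensive.
Import Order.TTheory GRing.Theory Num.Theory.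
Import numFieldNormedType.Exports.

Local Open Scope classical_set_scope.
Local Open Scope ring_scope.

(** * Distribution function of a density and its uniform law *)

Section density_measure_theory.
Context (R : realType) (w : prob_density R).
Local Notation mu := (@lebesgue_measure R).
Local Notation P := (density_measure w).
Local Notation F := (density_cdf w).

Let mw (D : set R) : measurable_fun D (EFin \o w).
Proof.
by apply/measurable_EFinP/measurable_funTS; exact: measurable_density.
Qed.

Lemma density_integrable (D : set R) : measurable D ->
  mu.-integrable D (EFin \o w).
Proof.
move=> mD; apply: (integrableS measurableT) => //; apply/integrableP; split.
  exact: mw.
under eq_integral do rewrite /= ger0_norm ?density_ge0//.
by rewrite integral_density ltry.
Qed.

Lemma density_measure_dominates : P `<< mu.
Proof.
apply/null_content_dominatesP => A mA A0.
apply: (null_set_integral mA _ A0); exact: mw.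
Qed.

(** [w] and the Radon-Nikodym derivative of [P] have the same integral over every measurable set, so
    they agree a.e. and can be exchanged in the change of variables. *)
Lemma ge0_integral_density_measure (f : R -> \bar R) :
  measurable_fun setT f -> (forall x, 0 <= f x)%E ->
  (\int[P]_x f x = \int[mu]_x (f x * (w x)%:E))%E.
Proof.
move=> mf f0.
rewrite -(Radon_Nikodym_SigmaFinite.change_of_variables
  density_measure_dominates f0 measurableT mf).
have intRN : mu.-integrable setT (Radon_Nikodym_SigmaFinite.f P mu).
  exact/Radon_Nikodym_SigmaFinite.f_integrable/density_measure_dominates.
apply: ae_eq_integral => //.
- by apply: emeasurable_funM => //; exact: measurable_int intRN.
- by apply: emeasurable_funM => //; exact: mw.
- apply: ae_eqe_mul2l; apply: integral_ae_eq => //; first exact: mw.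
  move=> E _ mE.
  rewrite -Radon_Nikodym_SigmaFinite.f_integral//.
  exact: density_measure_dominates.
Qed.

Lemma density_cdfE x : ((F x)%:E = P `]-oo, x])%E.
Proof.
rewrite /density_cdf /Rintegral fineK//.
by have := fin_num_measure P `]-oo, x]%classic; apply.
Qed.

Lemma density_cdf_nondecreasing x y : x <= y -> F x <= F y.
Proof.
move=> xy; rewrite -lee_fin !density_cdfE le_measure ?inE//.
exact: subitvPr.
Qed.

Lemma density_cdf_ge0 x : 0 <= F x.
Proof. by rewrite -lee_fin density_cdfE. Qed.

Lemma density_cdf_le1 x : F x <= 1.
Proof. by rewrite -lee_fin density_cdfE probability_le1. Qed.

(** Under [P] the identity is a random variable whose distribution function is [F]; the limits of
    [F] at both infinities come from this. *)
Let idR : measurableTypeR R -> R := idfun.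

#[local] HB.instance Definition _ :=
  @isMeasurableFun.Build _ _ _ _ idR (@measurable_id _ _ setT).

Let fine_cdf : fine \o cdf (idR : {RV P >-> R}) = F.
Proof. by apply/funext => x /=; rewrite /cdf/= -density_cdfE. Qed.

Lemma cvg_density_cdfNy : F x @[x --> -oo] --> (0 : R).
Proof. by rewrite -fine_cdf; exact/fine_cvg/cvg_cdfNy0. Qed.

Lemma cvg_density_cdfy : F x @[x --> +oo] --> (1 : R).
Proof. by rewrite -fine_cdf; exact/fine_cvg/cvg_cdfy1. Qed.

(** Around [x], [F] is the constant [F a] plus the integral of [w] from [a], which is continuous in
    its upper bound. *)
Lemma continuous_density_cdf : continuous F.
Proof.
move=> x; pose a := x - 1; pose b := x + 1.
have ab : a < b by rewrite /a /b ltrD2l gtrN.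
have : {within `[a, b], continuous F}.
  have FE : {in `[a, b]%classic,
      (fun y => F a + parameterized_integral mu a y w) =1 F}.
    move=> y /[!inE]/=; rewrite in_itv/= => /andP[ay yb].
    rewrite /parameterized_integral -Rintegral_itv_obnd_cbnd; last first.
      exact: density_integrable.
    rewrite -(@Rintegral_itvB _ _ -oo%O (BRight y) a) ?bnd_simp//; last first.
      exact: density_integrable.
    by rewrite addrC subrK.
  apply: (subspace_eq_continuous FE).
  move=> y; apply: cvgD; first exact: cvg_cst.
  apply: parameterized_integral_continuous; first exact: ltW.
  exact: density_integrable.
move=> /(continuous_within_itvP _ ab)[+ _ _]; apply.
by rewrite in_itv/= /a /b ltrDl ltr01 gtrDl ltrN10.
Qed.

Lemma measurable_density_cdf : measurable_fun setT F.
Proof.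
by apply: nondecreasing_measurable => //; exact: density_cdf_nondecreasing.
Qed.

Lemma density_cdf_surj p : 0 < p < 1 -> exists x, F x = p.
Proof.
move=> /andP[p0 p1].
have [a /ltW Fa] : exists a, F a < p.
  have /(_ _ _ p0) := cvgr_lt _ cvg_density_cdfNy.
  exact: filter_ex.
have [b /ltW Fb] : exists b, p < F b.
  have /(_ _ _ p1) := cvgr_gt _ cvg_density_cdfy.
  exact: filter_ex.
(* If [b < a], monotonicity squeezes [F a] to [p]; otherwise the intermediate value theorem
   applies. *)
have [ab|/ltW/density_cdf_nondecreasing ba] := leP a b; last first.
  by exists a; apply/eqP; rewrite eq_le Fa (le_trans Fb).
have [||x _ <-] := @IVT _ F a b p ab; last by exists x.
- exact/continuous_subspaceT/continuous_density_cdf.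
- by rewrite ge_min Fa le_max Fb orbT.
Qed.

Let mFle p : measurable [set x | F x <= p].
Proof.
have := measurable_density_cdf measurableT (measurable_itv `]-oo, p]).
by rewrite setTI preimage_itvNyc.
Qed.

Let mFlt p : measurable [set x | F x < p].
Proof.
have := measurable_density_cdf measurableT (measurable_itv `]-oo, p[).
by rewrite setTI preimage_itvNyo.
Qed.

(** With [F y = p], monotonicity puts this set inside the ray up to [y], which has mass [p]. *)
Let density_measure_cdf_lt p : 0 < p < 1 -> (P [set x | F x < p]%R <= p%:E)%E.
Proof.
move=> /density_cdf_surj[y Fy]; rewrite -Fy density_cdfE.
apply: le_measure; rewrite ?inE//=; first exact: mFlt.
move=> x /=; rewrite in_itv/= => xy; rewrite leNgt; apply: contraTN xy.
by move=> /ltW/density_cdf_nondecreasing; rewrite -leNgt.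
Qed.

(** Conversely, the ray up to [y] lies in this set. *)
Let density_measure_cdf_ge p : 0 < p < 1 -> (p%:E <= P [set x | F x <= p]%R)%E.
Proof.
move=> /density_cdf_surj[y Fy]; rewrite -[X in X%:E]Fy density_cdfE.
apply: le_measure; rewrite ?inE//; first exact: mFle.
by move=> x /=; rewrite in_itv/= -Fy; exact: density_cdf_nondecreasing.
Qed.

(** For [q] slightly above [p] the set lies in [F < q], of mass at most [q]. As [q] is positive,
    [p = 0] is covered. *)
Let density_measure_cdf_le p : 0 <= p < 1 -> (P [set x | F x <= p]%R <= p%:E)%E.
Proof.
move=> /andP[p0 p1].
have [e e0 ep] : exists2 e, 0 < e & e = 1 - p.
  by exists (1 - p); rewrite ?subr_gt0.
apply/lee_addgt0Pr => d d0.
(* The minimum keeps [q] within [d] of [p] and, [e] being [1 - p], below 1. *)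
pose q := p + Num.min d (e / 2).
have m0 : 0 < Num.min d (e / 2) by rewrite lt_min d0 divr_gt0.
have pq : p < q by rewrite ltrDl.
have q1 : q < 1.
  rewrite -ltrBrDl -ep gt_min; apply/orP; right.
  by rewrite ltr_pdivrMr// ltr_pMr// ltr1n.
have qd : q <= p + d by rewrite lerD2l ge_min lexx.
apply: (@le_trans _ _ q%:E); last by rewrite -EFinD lee_fin.
apply: le_trans (density_measure_cdf_lt _); last first.
  by rewrite q1 (le_lt_trans p0).
apply: le_measure; rewrite ?inE; [exact: mFle|exact: mFlt|].
by move=> x /= /le_lt_trans; exact.
Qed.

Lemma density_measure_cdf p : 0 <= p <= 1 -> (P [set x | F x <= p]%R = p%:E)%E.
Proof.
move=> /andP[p0 p1]; have [->|p1'] := eqVneq p 1.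
  rewrite (_ : [set x | _] = setT); first exact: probability_setT.
  by apply/seteqP; split=> // x _; exact: density_cdf_le1.
apply/eqP; rewrite eq_le density_measure_cdf_le ?p0 ?lt_neqAle ?p1'//=.
have [<-//|p0'] := eqVneq 0 p.
by rewrite density_measure_cdf_ge// !lt_neqAle p0' p0 p1' p1.
Qed.

Lemma ae_density_cdf_itv : {ae P, forall x, 0 < F x < 1}.
Proof.
have F0 : {ae P, forall x, 0 < F x}.
  exists [set x | F x <= 0]; split; first exact: mFle.
    by rewrite density_measure_cdf// lexx ler01.
  by move=> x /= /negP; rewrite -leNgt.
have F1 : {ae P, forall x, F x < 1}.
  have mF1 : measurable (~` [set x | F x < 1]).
    by apply: measurableC; exact: mFlt.
  exists (~` [set x | F x < 1]); split=> //.
  apply/eqP; rewrite eq_le measure_ge0 andbT; apply/lee_addgt0Pr => d d0.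
  (* The set where [F] reaches 1 lies outside [F <= 1 - d], so its mass is at most [d]; the maximum
     with 0 keeps the level in the unit interval when [d > 1]. *)
  have c01 : 0 <= Num.max 0 (1 - d) <= 1.
    by rewrite le_max lexx/= ge_max ler01 gerBl ltW.
  apply: (@le_trans _ _ (P (~` [set x | F x <= Num.max 0 (1 - d)]))).
    apply: le_measure; rewrite ?inE//.
      by apply: measurableC; exact: mFle.
    apply: subsetC => x /= /le_lt_trans; apply.
    by rewrite gt_max ltr01 gtrBl.
  have -> : P (~` [set x | F x <= Num.max 0 (1 - d)]) =
      (1 - (Num.max 0 (1 - d))%:E)%E.
    rewrite probability_setC; last exact: mFle.
    by congr (_ - _)%E; exact: density_measure_cdf.
  rewrite -EFinB add0e lee_fin.
  by rewrite lerBlDr -lerBlDl le_max lexx orbT.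
apply: (@filterS2 _ _ (@ae_filter_ringOfSetsType _ _ _ P) _ _ _ _ F0 F1).
by move=> x -> ->.
Qed.

End density_measure_theory.

(** * Quantile functions and their measurability *)

Section quantile.
Context (R : realType) (w : prob_density R).
Local Notation F := (density_cdf w).

(** This Galois connection carries all later facts on quantiles. If [F x < p], a point [y] where [F]
    lies strictly between [F x] and [p] is a lower bound of the superlevel set, and [x < y]. *)
Lemma quantile_le p x : 0 < p < 1 -> (quantile w p <= x) = (p <= F x).
Proof.
move=> /andP[p0 p1].
have lbE a : F a < p -> lbound [set x | p <= F x] a.
  move=> Fa y /=; apply: contraTT; rewrite -!ltNge => /ltW ya.
  exact: le_lt_trans (density_cdf_nondecreasing _ ya) Fa.
apply/idP/idP => [|pFx]; last first.
  apply: ge_inf => //.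
  (* A point where [F] is [p / 2] bounds the superlevel set below, so [inf] is a true infimum and
     not its default value. *)
  have [|a Fa] := @density_cdf_surj _ w (p / 2).
    by rewrite divr_gt0//= ltr_pdivrMr// mul1r (lt_trans p1)// ltr1n.
  by exists a; apply: lbE; rewrite Fa ltr_pdivrMr// ltr_pMr// ltr1n.
apply: contraTT; rewrite -!ltNge => Fxp.
have [|y Fy] := @density_cdf_surj _ w ((F x + p) / 2).
  by have := density_cdf_ge0 w x; lra.
apply: (@lt_le_trans _ _ y).
  rewrite ltNge; apply/negP => /(density_cdf_nondecreasing w).
  by rewrite Fy; lra.
apply: lb_le_inf; last by apply: lbE; rewrite Fy; lra.
have [|z Fz] := @density_cdf_surj _ w p; first by rewrite p0.
by exists z; rewrite /= Fz.
Qed.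

Lemma measurable_quantile : measurable_fun (`]0, 1[ : set R) (quantile w).
Proof.
apply: (measurability (@RGenOInfty.G R)) => [|/= _ [_ [x ->] <-]].
  exact: RGenOInfty.measurableE.
rewrite (_ : _ `&` _ = `]0%R, 1%R[ `&` `]F x, +oo[); first exact: measurableI.
apply/seteqP; split=> p /=; rewrite !in_itv/= !andbT => -[p01].
  by rewrite ltNge quantile_le// -ltNge.
by move=> Fxp; split=> //; rewrite ltNge quantile_le// -ltNge.
Qed.

(* Outside [0 < F < 1] the composite takes only the values [q 0] and [q 1]. *)
Lemma measurable_comp_density_cdf (q : R -> R) :
  measurable_fun (`]0, 1[ : set R) q -> measurable_fun setT (q \o F).
Proof.
move=> mq.
have qF : q \o F = (fun p : R => if 0 < p < 1 then q p
    else if p < 1 then q 0 else q 1) \o F.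
  apply/funext => x /=; case: ifPn => //; rewrite negb_and -!leNgt.
  case/orP => [Fx0|Fx1].
    have -> : F x = 0 by apply/eqP; rewrite eq_le Fx0 density_cdf_ge0.
    by rewrite ltr01.
  have -> : F x = 1 by apply/eqP; rewrite eq_le Fx1 density_cdf_le1.
  by rewrite ltxx.
rewrite qF; apply: measurableT_comp; last exact: measurable_density_cdf.
apply: measurable_fun_if => //.
- by apply: measurable_and; exact: measurable_fun_ltr.
- by rewrite setTI (_ : _ @^-1` _ = `]0, 1[%classic).
- apply: measurable_funTS; apply: measurable_fun_ifT => //.
  exact: measurable_fun_ltr.
Qed.

End quantile.

(** * Probabilities determined by their distribution functions *)

Section probability_unique.
Context (R : realType) (P1 P2 : probability (measurableTypeR R) R).

(** The open upper rays are stable under intersection and generate the Borel sets; their masses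
    follow by complement. *)
Lemma probability_itvNyc_unique :
  (forall x, P1 `]-oo, x]%classic = P2 `]-oo, x]%classic) ->
  forall A, measurable A -> P1 A = P2 A.
Proof.
move=> P12 A mA; apply: (@measure_unique _ R (measurableTypeR R)
  (@RGenOInfty.G R) (fun k => `](- k%:R), +oo[%classic)) => //.
- exact: RGenOInfty.measurableE.
- move=> _ _ [x ->] [y ->]; exists (Num.max x y); apply/seteqP.
  by split=> z /=; rewrite !in_itv/= !andbT gt_max => /andP.
- by move=> k; exists (- k%:R).
- rewrite -subTset => x _; exists (Num.bound x) => //=.
  by rewrite in_itv/= andbT ltrNl ltrNbound.
- move=> _ [x ->].
  have PE (P : probability (measurableTypeR R) R) :
      P `]x, +oo[%classic = (1 - P `]-oo, x]%classic)%E.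
    by rewrite -setCitvl probability_setC.
  by rewrite [LHS]PE [RHS]PE P12.
- by move=> k; rewrite (le_lt_trans (probability_le1 _ _))// ltry.
Qed.

End probability_unique.

(** * Translation invariance of Lebesgue measure *)

Section lebesgue_translation.
Context (R : realType).
Local Notation mu := (@lebesgue_measure R).

Let measurable_translation (c : R) :
  measurable_fun setT (+%R^~ c : measurableTypeR R -> measurableTypeR R).
Proof.
by apply: measurable_funD; [exact: measurable_id|exact: measurable_cst].
Qed.

(** The pushforward gives half-open intervals their length, which characterizes Lebesgue measure. *)
Lemma lebesgue_measure_translation (c : R) (A : set R) : measurable A ->
  pushforward mu (+%R^~ c : _ -> measurableTypeR R) A = mu A.
Proof.
move=> mA.
pose phi := HB.pack_for {mfun measurableTypeR R >-> measurableTypeR R}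
  (+%R^~ c : measurableTypeR R -> measurableTypeR R)
  (isMeasurableFun.Build _ _ _ _ _ (measurable_translation c)).
apply/esym/(@lebesgue_measure_unique _ (pushforward mu phi)) => //.
move=> _ [[a b]] _ <- /=; transitivity (mu `]a - c, b - c]%classic).
  rewrite !lebesgue_measure_itv/= !lte_fin ltrD2r.
  by rewrite -!EFinB (_ : b - c - (a - c) = b - a)//; lra.
congr (mu _); apply/seteqP.
by split=> x /=; rewrite !in_itv/= ltrBlDr lerBrDr.
Qed.

Lemma ge0_integral_translation (c : R) (D : set R) (f : R -> \bar R) :
  measurable D -> measurable_fun D f -> (forall x, 0 <= f x)%E ->
  (\int[mu]_(x in (+%R^~ c) @^-1` D) f (x + c)%R = \int[mu]_(x in D) f x)%E.
Proof.
move=> mD mf f0.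
pose phi := HB.pack_for {mfun measurableTypeR R >-> measurableTypeR R}
  (+%R^~ c : measurableTypeR R -> measurableTypeR R)
  (isMeasurableFun.Build _ _ _ _ _ (measurable_translation c)).
rewrite -(@ge0_integral_pushforward _ _ _ _ _ _
  (measurable_translation c) mu D f)//.
by apply: (@eq_measure_integral _ _ _ _ mu (pushforward mu phi)) => A mA _;
  exact: lebesgue_measure_translation.
Qed.

End lebesgue_translation.

(** * Quantiles of a translated density *)

Section advection.
Context (R : realType) (w : prob_density R).

Lemma density_cdf_advected A t x :
  density_cdf (advected A w ^~ t) x = density_cdf w (x - A * t).
Proof.
congr fine; rewrite -(@ge0_integral_translation _ (- (A * t)) _ (EFin \o w))//.
- congr (integral _ _ _); apply/seteqP.
  by split=> y /=; rewrite !in_itv/= lerD2r.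
- by apply/measurable_EFinP/measurable_funTS; exact: measurable_density.
- by move=> y; rewrite lee_fin density_ge0.
Qed.

Lemma quantile_advected A t p : 0 < p < 1 ->
  quantile (advected A w ^~ t) p = quantile w p + t * A.
Proof.
move=> p01; rewrite /quantile.
(* By [quantile_le] the superlevel set is a closed ray, whose infimum is its endpoint. *)
rewrite (_ : [set x | _] = `[quantile w p + t * A, +oo[%classic).
  by rewrite inf_itv.
apply/seteqP; split=> x /=; rewrite in_itv/= andbT density_cdf_advected.
  by rewrite -quantile_le// lerBrDr mulrC.
by rewrite -quantile_le// lerBrDr mulrC.
Qed.

End advection.

Lemma measure_ae_eq d (T : measurableType d) (R : realType)
    (mu : {measure set T -> \bar R}) (A B : set T) :
  measurable A -> measurable B -> {ae mu, forall x, A x <-> B x} ->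
  mu A = mu B.
Proof.
move=> mA mB AB; rewrite -[A]setIT -[B]setIT -!integral_indic//.
apply: ae_eq_integral => //.
- by apply/measurable_EFinP; exact: measurable_indic.
- by apply/measurable_EFinP; exact: measurable_indic.
- by apply: filterS AB => x AB _; rewrite !indicE; congr (_ _)%:E;
    congr (nat_of_bool _); apply/idP/idP; rewrite !inE => /AB.
Qed.

(** * The CDT as a transport map *)

Section cdt.
Context (R : realType) (r w : prob_density R).
Local Notation P := (density_measure r).
Local Notation G := (density_cdf r).

Lemma measurable_cdt :
  measurable_fun setT (cdt r w : measurableTypeR R -> measurableTypeR R).
Proof.
apply: (@measurable_comp_density_cdf _ r (quantile w)).
exact: measurable_quantile.
Qed.

(** It suffices to test lower rays: a.e. [cdt r w y <= x] means [G y <= density_cdf w x], and [G] is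
    uniform under [P]. *)
Lemma density_measure_preimage_cdt (A : set R) : measurable A ->
  P (cdt r w @^-1` A) = density_measure w A.
Proof.
pose X := HB.pack_for {mfun measurableTypeR R >-> measurableTypeR R}
  (cdt r w : measurableTypeR R -> measurableTypeR R)
  (isMeasurableFun.Build _ _ _ _ _ measurable_cdt).
apply: (@probability_itvNyc_unique _ (distribution P X) (density_measure w)).
move=> x; transitivity (density_cdf w x)%:E; last exact: density_cdfE.
transitivity (P [set y | G y <= density_cdf w x]); last first.
  by apply: density_measure_cdf; rewrite density_cdf_ge0 density_cdf_le1.
apply: (@measure_ae_eq _ _ _ P).
- by rewrite -[X in measurable X]setTI; exact: measurable_cdt.
- have := measurable_density_cdf r measurableT
    (measurable_itv `]-oo, density_cdf w x]).
  by rewrite setTI preimage_itvNyc.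
- apply: (@filterS _ _ (@ae_filter_ringOfSetsType _ _ _ P) _ _ _
    (ae_density_cdf_itv r)) => y Gy /=.
  by rewrite in_itv/= /cdt quantile_le.
Qed.

Lemma ge0_integral_cdt (f : R -> \bar R) :
  measurable_fun setT f -> (forall x, 0 <= f x)%E ->
  (\int[P]_x f (cdt r w x) = \int[density_measure w]_x f x)%E.
Proof.
move=> mf f0.
pose X := HB.pack_for {mfun measurableTypeR R >-> measurableTypeR R}
  (cdt r w : measurableTypeR R -> measurableTypeR R)
  (isMeasurableFun.Build _ _ _ _ _ measurable_cdt).
rewrite -(@ge0_integral_pushforward _ _ _ _ _ _ measurable_cdt P setT f)//.
apply: (@eq_measure_integral _ _ _ _ (density_measure w) (pushforward P X)).
by move=> A mA _; exact: density_measure_preimage_cdt.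
Qed.

Lemma cdt_Lfun2 : finite_second_moment w -> cdt r w \in Lfun P 2%:E.
Proof.
move=> w2; rewrite inE; apply/andP; split; rewrite inE/=.
  exact: measurable_cdt.
rewrite /finite_norm unlock poweR_lty//.
under eq_integral do rewrite /= powR_mulrn// -normrX ger0_norm ?sqr_ge0//.
rewrite (@ge0_integral_cdt (fun y => (y ^+ 2)%:E))//; last first.
- by move=> y; rewrite lee_fin sqr_ge0.
- by apply/measurable_EFinP; exact: measurable_funX.
rewrite ge0_integral_density_measure//.
- by apply/measurable_EFinP; exact: measurable_funX.
- by move=> y; rewrite lee_fin sqr_ge0.
Qed.

(** [advected A w ^~ t] is a bare function, not a [prob_density], so measurability is read off the
    translated quantile on the open unit interval. *)
Lemma measurable_cdt_advected A t :
  measurable_fun setT (cdt r (advected A w ^~ t)).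
Proof.
apply: (@measurable_comp_density_cdf _ r (quantile (advected A w ^~ t))).
apply: (@eq_measurable_fun _ _ _ _ _ (fun p => quantile w p + t * A)).
  by move=> p; rewrite inE/= in_itv/= => p01; rewrite quantile_advected.
by apply: measurable_funD => //; exact: measurable_quantile.
Qed.

(** Only a.e.: where [density_cdf r] is 0 or 1, [quantile] may be a default value. *)
Lemma cdt_advected A t :
  {ae P, forall x, cdt r (advected A w ^~ t) x = cdt r w x + t * A}.
Proof.
apply: (@filterS _ _ (@ae_filter_ringOfSetsType _ _ _ P) _ _ _
  (ae_density_cdf_itv r)) => y Gy /=.
by rewrite /cdt quantile_advected.
Qed.

End cdt.

(** * Linear spans and dimension *)

Section linear_span_theory.
Context (R : realType) (V : lmodType R).
Implicit Types S : set V.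

Lemma sub_lin_span S : S `<=` lin_span S.
Proof.
move=> v Sv; exists 1, (fun=> 1), (fun=> v); split=> //.
by rewrite big_ord1 scale1r.
Qed.

Lemma lin_span0 S : lin_span S 0.
Proof.
exists 0, (fun=> 0), (fun=> 0); split; first by case.
by rewrite big_ord0.
Qed.

Lemma lin_spanD S u v : lin_span S u -> lin_span S v -> lin_span S (u + v).
Proof.
move=> [k [c [x [Sx ->]]]] [l [d [y [Sy ->]]]].
exists (k + l)%N,
  (fun i => match fintype.split i with inl a => c a | inr b => d b end),
  (fun i => match fintype.split i with inl a => x a | inr b => y b end).
split=> [i|]; first by case: fintype.split.
rewrite big_split_ord/=; congr (_ + _); apply: eq_bigr => i _.
  by rewrite (unsplitK (inl i)).
by rewrite (unsplitK (inr i)).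
Qed.

Lemma lin_spanZ S a v : lin_span S v -> lin_span S (a *: v).
Proof.
move=> [k [c [x [Sx ->]]]]; exists k, (fun i => a * c i), x; split=> //.
by rewrite scaler_sumr; under eq_bigr do rewrite scalerA.
Qed.

Lemma lin_span_sum S k (x : 'I_k -> V) :
  (forall i, lin_span S (x i)) -> lin_span S (\sum_i x i).
Proof.
move=> Sx; apply: big_ind => //; first exact: lin_span0.
exact: lin_spanD.
Qed.

Lemma lin_span_subset S S' : S `<=` lin_span S' -> lin_span S `<=` lin_span S'.
Proof.
move=> SS' _ [k [c [x [Sx ->]]]]; apply: lin_span_sum => i.
exact/lin_spanZ/SS'/Sx.
Qed.

(** [dim_le] asks for an independent family, which [x] need not be. In a nontrivial relation, a
    vector with nonzero coefficient is redundant; dropping it lowers [k]. *)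
Lemma dim_le_lin_span k (x : 'I_k -> V) : dim_le k (lin_span (range x)).
Proof.
elim: k x => [|k IHk] x.
  by exists 0, x; split=> // c _ [].
have [?|] := pselect (lin_indep x); first by exists k.+1, x.
move=> /existsNP[c] /not_implyP[cx] /existsNP[i] /eqP ci0.
have [l [b [lk bfree bspan]]] := IHk (x \o lift i).
exists l, b; split; [exact: leqW|by []|rewrite -bspan].
apply/seteqP; split; apply: lin_span_subset.
  move=> _ [j _ <-]; have [m ->|->] := unliftP i j.
    by apply: sub_lin_span; exists m.
  (* The relation [cx] solved for [x i], checked after multiplying by [c i]. *)
  have -> : x i = \sum_m (- (c i)^-1 * c (lift i m)) *: x (lift i m).
    apply: (scalerI ci0); rewrite scaler_sumr.
    under eq_bigr do rewrite scalerA mulrA mulrN divff// mulN1r scaleNr.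
    apply/eqP; rewrite sumrN -addr_eq0 -[X in _ == X]cx.
    by rewrite [eqbRHS](bigD1_ord i).
  by apply: lin_span_sum => m; apply/lin_spanZ/sub_lin_span; exists m.
by move=> _ [m _ <-]; apply: sub_lin_span; exists (lift i m).
Qed.

Lemma dim_leS m n (W : set V) : (m <= n)%N -> dim_le m W -> dim_le n W.
Proof.
by move=> mn [k [b [km bf ->]]]; exists k, b; split=> //; exact: leq_trans mn.
Qed.

End linear_span_theory.

(** * Vanishing of the Kolmogorov width *)

Lemma kolmogorov_width_eq0 (R : realType) (H : normedModType R) (n : nat)
    (S V : set H) :
  S !=set0 -> dim_le n V -> S `<=` V -> kolmogorov_width n S = 0%E.
Proof.
move=> [s Ss] nV SV; apply/eqP; rewrite eq_le; apply/andP; split.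
  apply: ge_ereal_inf.
  exists (ereal_sup [set ereal_inf [set `|w - h|%:E | h in V] | w in S]).
    by exists V.
  apply: ge_ereal_sup => _ [w Sw <-]; apply: ge_ereal_inf.
  by exists `|w - w|%:E; [exists w => //; exact: SV|rewrite subrr normr0].
apply: le_ereal_inf_tmp => _ [W _ <-].
(* The point [s] bounds the supremum below by a nonnegative distance; over an empty [S] that
   supremum would be minus infinity. *)
apply: (@le_trans _ _ (ereal_inf [set `|s - h|%:E | h in W])).
  by apply: le_ereal_inf_tmp => _ [h _ <-]; rewrite lee_fin.
by apply: ereal_sup_ubound; exists s.
Qed.

(** * Classes of functions in L^p *)

Section Lspace_class_theory.
Context d (T : measurableType d) (R : realType).
Variables (mu : {measure set T -> \bar R}) (p : \bar R) (p1 : (1 <= p)%E).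

Lemma ae_eq_Lfun (f g : T -> R) :
  f \in Lfun mu p -> measurable_fun setT g -> g = f %[ae mu] -> g \in Lfun mu p.
Proof.
move=> /andP[]; rewrite !inE /= => mf fp mg gf; apply/andP.
by split; rewrite inE//= /finite_norm (ae_eq_Lnorm p1 mg mf gf).
Qed.

(** Membership in [Lfun] makes each [insubd] return the function itself rather than the default 0;
    the a.e. identity then passes to classes. *)
Lemma Lspace_class_addZ (f g h : T -> R) (c : R) :
  f \in Lfun mu p -> g \in Lfun mu p -> h \in Lfun mu p ->
  h = f + c *: g %[ae mu] ->
  Lspace_class mu p1 h = Lspace_class mu p1 f + c *: Lspace_class mu p1 g.
Proof.
move=> fL gL hL hfg.
have insubdE k : k \in Lfun mu p ->
    (insubd (0 : LfunType mu p1) k : T -> R) = k.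
  move=> kL; rewrite -[LHS]/(val (insubd (0 : LfunType mu p1) k)).
  by rewrite val_insubd kL.
rewrite /Lspace_class -Lspace_of_LfunZ -Lspace_of_LfunD; apply/Lspace_eqP.
apply: filterS hfg => x hx _; rewrite insubdE// hx//.
change (f x + c * g x = (insubd (0 : LfunType mu p1) f : T -> R) x +
  c * (insubd (0 : LfunType mu p1) g : T -> R) x).
by rewrite !insubdE.
Qed.

End Lspace_class_theory.

Theorem mainTheorem5 (R : realType) (A T : R) (u0 r : prob_density R) :
  0 < T ->
  (u0 : R -> R) \in Lfun lebesgue_measure 2%:E ->
  finite_second_moment u0 ->
  let u := advected A u0 in
  let M := transformed_manifold r u T in
  let u0hat := L2_class r (cdt r u0) in
  let one := L2_class r (cst 1) in
  [/\ [/\ cdt r u0 \in Lfun (density_measure r) 2%:E,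
          (cst 1 : R -> R) \in Lfun (density_measure r) 2%:E &
          forall t, t \in `[0, T] ->
            cdt r (u ^~ t) \in Lfun (density_measure r) 2%:E],
      M = [set u0hat + (t * A) *: one | t in `[0, T]],
      M `<=` lin_span [set u0hat; one] &
      forall n : nat, (2 <= n)%N -> kolmogorov_width n M = 0%E].
Proof.
move=> T0 _ u0_moment u M u0hat one.
have u0L : cdt r u0 \in Lfun (density_measure r) 2%:E by exact: cdt_Lfun2.
have oneL : (cst 1 : R -> R) \in Lfun (density_measure r) 2%:E.
  exact: Lfun_cst.
have utE t : {ae density_measure r, forall x,
    setT x -> cdt r (u ^~ t) x = (cdt r u0 + (t * A) *: cst 1) x}.
  apply: (@filterS _ _ (@ae_filter_ringOfSetsType _ _ _ (density_measure r))
    _ _ _ (cdt_advected r u0 A t)) => x -> _.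
  by rewrite -[RHS]/(cdt r u0 x + t * A * 1) mulr1.
have utL t : cdt r (u ^~ t) \in Lfun (density_measure r) 2%:E.
  (* Square integrability is transferred along [utE] from this sum, whose terms are both in L^2
     because [density_measure r] is a finite measure. *)
  have u0oneL : cdt r u0 + (t * A) *: cst 1 \in Lfun (density_measure r) 2%:E.
    apply: rpredD => [|//|le12]; first exact: lee1n.
    rewrite (_ : _ *: _ = cst (t * A)); first exact: Lfun_cst.
    by apply/funext => x; rewrite -[LHS]/(t * A * 1) mulr1.
  apply: (ae_eq_Lfun (lee1n 2) u0oneL _ (utE t)).
  exact: measurable_cdt_advected.
have L2_ut t : L2_class r (cdt r (u ^~ t)) = u0hat + (t * A) *: one.
  exact: Lspace_class_addZ.
have ME : M = [set u0hat + (t * A) *: one | t in `[0, T]].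
  by apply: eq_imagel => t _; exact: L2_ut.
have Mspan : M `<=` lin_span [set u0hat; one].
  rewrite ME => _ [t _ <-]; apply: lin_spanD.
    by apply: sub_lin_span; left.
  by apply: lin_spanZ; apply: sub_lin_span; right.
split=> // n n2.
apply: (@kolmogorov_width_eq0 _ _ _ _ (lin_span [set u0hat; one])) => //.
  (* The time 0, in the interval since [0 < T], shows that the manifold is nonempty. *)
  exists (L2_class r (cdt r (u ^~ 0))); exists 0 => //=.
  by rewrite in_itv/= lexx ltW.
apply: (dim_leS n2).
(* The pair is viewed as a family over ['I_2]; its members may coincide or be proportional, which
   [dim_le_lin_span] allows. *)
rewrite (_ : [set u0hat; one] =
  range (fun i : 'I_2 => if i == 0 then u0hat else one)).
  exact: dim_le_lin_span.
apply/seteqP; split=> [v [->|->]|_ [i _ <-]] /=; first by exists 0.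
  by exists 1.
by case: ifP => _; [left|right].
Qed.
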